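(* Let $F$ be an algebraically closed field of characteristic $0$, let $G$ be a finitely generated additive abelian group, $\beta:G\times G\to F^\times$ an alternating bicharacter, and let $(G,\beta,R)$ be a reduced skew root system of Lie type. Let $L(R)$ be the associated Lie algebra (possibly infinite dimensional). Then: (1) $R$ is indecomposable if and only if $L(R)$ is simple. (2) If $(G,\beta,R)$ is a direct sum of indecomposable skew root systems $(G_i,\beta_i,R_i)$ for $i=1,\dots,n$, then $L(R)$ is the direct sum of the simple Lie algebras $L(R_i)$.
   Context: An alternating bicharacter is a $\mathbb{Z}$-bilinear map $\beta:G\times G\to F^\times$ with $\beta(g,g)=1$ for all $g\in G$; its radical is $\mathrm{Rad}(\beta)=\{g\in G:\beta(g,h)=1\text{ for all }h\in G\}$. $\beta$ is nonsingular if $\mathrm{Rad}(\beta)=0$. Subsets $A,B\subseteq G$ are orthogonal if $\beta(a,b)=1$ for all $a\in A$, $b\in B$. Skew root system of Lie type $(G,\beta,R)$: $\mathrm{Rad}(\beta)\neq G$ and $R\subseteq G$ satisfies: (SRSL0) $R\subseteq G\setminus\mathrm{Rad}(\beta)$ and $R$ generates $G$; (SRSL1) $a\in R$ implies $-a\in R$; (SRSL2) if $a,b\in R$ and $\beta(a,b)\neq 1$, then $a+b\in R$. It is reduced if $\beta$ is nonsingular. Decomposable: $(G,\beta,R)$ is decomposable if $G$ is the orthogonal direct sum of two proper subgroups $G_1,G_2$, $R$ is the union of two orthogonal subsets $R_1,R_2$, and for $i=1,2$, $R_i$ is a skew root system of Lie type in $(G_i,\beta_i)$ with $\beta_i=\beta|_{G_i\times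 G_i}$; then $(G,\beta,R)$ is called the direct sum of the $(G_i,\beta_i,R_i)$. Direct sums of finitely many skew root systems of Lie type are defined in the same way. Indecomposable means not decomposable. The algebra $L(R)$: choose a 2-cocycle $\xi\in Z^2(G,F^\times)$ (trivial action) with $\xi(a,b)\xi(b,a)^{-1}=\beta(a,b)$ for all $a,b\in G$ (such $\xi$ exists, and different choices give isomorphic graded algebras). The twisted group algebra $F^\xi G$ is the associative algebra with basis $\{u_g: g\in G\}$ and product $u_au_b=\xi(a,b)u_{a+b}$. Then $L(R)=\bigoplus_{a\in R}Fu_a\subseteq F^\xi G$ with bracket $[x,y]=xy-yx$. *)

(* Defs.v *)
From HB Require Import structures.
From mathcomp Require Import all_boot all_order all_algebra.
From mathcomp Require Import finmap.
From mathcomp Require Import mathcomp_extra boolp classical_sets.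
From mathcomp.multinomials Require Import monalg.

Set Implicit Arguments.
Unset Strict Implicit.
Unset Printing Implicit Defensive.

Import GRing.Theory.

Local Open Scope classical_set_scope.
Local Open Scope ring_scope.

Definition subgroup (G : zmodType) (H : set G) : Prop := zmod_closed [in H].

Definition subgroup_generated (G : zmodType) (S : set G) : set G :=
  smallest (@subgroup G) S.

Definition finitely_generated (G : zmodType) : Prop :=
  exists s : seq G, subgroup_generated [set` s] = [set: G].

(* A is the internal direct sum of the n subsets B i (which will be subgroups
   or subspaces); n = 0 is allowed. *)
Definition internal_direct_sum (V : zmodType) (A : set V)
    (n : nat) (B : 'I_n -> set V) : Prop :=
  (forall i, B i `<=` A) /\
  (forall x, A x ->
     exists! f : {ffun 'I_n -> V}, (forall i, B i (f i)) /\ x = \sum_i f i).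

Section SkewRootSystems.
Variables (F : fieldType) (G : zmodType) (beta : G -> G -> F).

Record alternating_bicharacter : Prop := AlternatingBicharacter {
  bichar_neq0 : forall a b, beta a b != 0;
  bicharDl : forall a b c, beta (a + b) c = beta a c * beta b c;
  bicharDr : forall a b c, beta a (b + c) = beta a b * beta a c;
  bichar_alt : forall a, beta a a = 1 }.

Definition orthogonal_subsets (A B : set G) : Prop :=
  forall a b, A a -> B b -> beta a b = 1.

(* In what follows H is a subgroup of G, and (H, beta, R) stands for the triple
   (H, beta restricted to H x H, R). *)

Definition radical (H : set G) : set G :=
  [set g | H g /\ forall h, H h -> beta g h = 1].

Record skew_root_system (H R : set G) : Prop := SkewRootSystem {
  srs_subgroup : subgroup H;
  srs_rad : radical H <> H;
  srs_sub : R `<=` H `\` radical H;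
  srs_gen : subgroup_generated R = H;
  srs_opp : forall a, R a -> R (- a);
  srs_add : forall a b, R a -> R b -> beta a b <> 1 -> R (a + b) }.

Definition reduced_skew_root_system (H R : set G) : Prop :=
  skew_root_system H R /\ radical H = [set 0].

Record srs_direct_sum (H R : set G) (n : nat) (Hs Rs : 'I_n -> set G) : Prop :=
  SrsDirectSum {
  srs_sum_group : internal_direct_sum H Hs;
  srs_sum_group_orth :
    forall i j, i != j -> orthogonal_subsets (Hs i) (Hs j);
  srs_sum_roots : R = \bigcup_i Rs i;
  srs_sum_roots_orth :
    forall i j, i != j -> orthogonal_subsets (Rs i) (Rs j);
  srs_sum_srs : forall i, skew_root_system (Hs i) (Rs i) }.

Definition decomposable (H R : set G) : Prop :=
  exists Hs Rs : 'I_2 -> set G,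
    srs_direct_sum H R Hs Rs /\ (forall i, Hs i `<` H).

Definition indecomposable (H R : set G) : Prop := ~ decomposable H R.

End SkewRootSystems.

(* Lie algebras as subspaces L of a vector space V, with a bracket br which is
   only required to satisfy the Lie axioms on L. *)
Section LieAlgebras.
Variables (F : fieldType) (V : lmodType F) (br : V -> V -> V).

Record lie_algebra (L : set V) : Prop := LieAlgebra {
  lie_subspace : submod_closed [in L];
  lie_closed : forall x y, L x -> L y -> L (br x y);
  lie_linearl : forall c x y z, L x -> L y -> L z ->
    br (c *: x + y) z = c *: br x z + br y z;
  lie_linearr : forall c x y z, L x -> L y -> L z ->
    br z (c *: x + y) = c *: br z x + br z y;
  lie_alt : forall x, L x -> br x x = 0;
  lie_jacobi : forall x y z, L x -> L y -> L z ->
    br x (br y z) + br y (br z x) + br z (br x y) = 0 }.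

Record lie_ideal (L I : set V) : Prop := LieIdeal {
  ideal_sub : I `<=` L;
  ideal_subspace : submod_closed [in I];
  ideal_br : forall x y, L x -> I y -> I (br x y) }.

Record lie_simple (L : set V) : Prop := LieSimple {
  simple_lie : lie_algebra L;
  simple_nonabelian : exists x y, [/\ L x, L y & br x y <> 0];
  simple_ideals : forall I, lie_ideal L I -> I = [set 0] \/ I = L }.

Record lie_direct_sum (L : set V) (n : nat) (Ls : 'I_n -> set V) : Prop :=
  LieDirectSum {
  lie_sum_lie : lie_algebra L;
  lie_sum_ideal : forall i, lie_ideal L (Ls i);
  lie_sum_direct : internal_direct_sum L Ls }.

End LieAlgebras.

Section TwistedGroupAlgebra.
Variables (F : fieldType) (G : zmodType) (xi : G -> G -> F).

Record cocycle2 : Prop := Cocycle2 {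
  cocycle_neq0 : forall a b, xi a b != 0;
  cocycleP : forall a b c,
    xi b c * xi a (b + c) = xi (a + b) c * xi a b }.

(* The underlying space of the twisted group algebra is {malg F[G]}, the
   finitely supported functions G -> F, whose basis element u_g is << g >>;
   this is the bilinear extension of u_a u_b = xi(a, b) u_(a + b). *)
Definition twisted_mul (x y : {malg F[G]}) : {malg F[G]} :=
  \sum_(a <- msupp x) \sum_(b <- msupp y)
    << x@_a * y@_b * xi a b *g (a + b)%R >>.

Definition twisted_bracket (x y : {malg F[G]}) : {malg F[G]} :=
  twisted_mul x y - twisted_mul y x.

End TwistedGroupAlgebra.

(* The span of the u_a with a in R. For R contained in a subgroup H of G, the
   twisted group algebra of H for the restriction of xi is the span of the u_h
   with h in H, with the same product; so the Lie algebra of (H, beta, R) built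
   from this restriction is root_space F R under twisted_bracket xi. *)
Definition root_space (F : fieldType) (G : zmodType) (R : set G) :
    set {malg F[G]} :=
  [set x | forall a, x@_a != 0 -> R a].
Arguments root_space F {G} R.

(* Main.v *)
Require Import Defs.
From mathcomp Require Import all_boot all_order all_algebra finmap.
From mathcomp Require Import boolp classical_sets.
From mathcomp Require Import ring.
From mathcomp.multinomials Require Import monalg.

(** The idea is to read both sides of the equivalence on the graph whose
vertices are the roots, with an edge between a and b when beta(a, b) <> 1.

Combinatorial side: R is indecomposable exactly when this graph is connected.
A nonempty set C of roots closed under adjacency has its complement D closed
under adjacency too, so C and D are orthogonal, hence so are the subgroups they
generate; these two subgroups add up to the whole group, and they meet in 0
because an element of both is orthogonal to everything. So if D is nonempty
then R is decomposable ([indecomposable_closed]).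

Lie side: [u_a, u_b] is a nonzero multiple of u_(a+b) when a and b are adjacent
and 0 otherwise. If an ideal I contains u_a, and b is adjacent to a, then I
contains u_(a+b), and so u_b, which is up to a nonzero scalar the bracket of
u_(-a) and u_(a+b). Thus the roots a with u_a in I form a set closed under
adjacency, and if R is indecomposable it only remains to find one u_a in a
nonzero ideal ([indecomposable_simple]).

There is no torus in L(R) to split an ideal into homogeneous parts, but its role
is partly played by the operators ad(u_(-b)) ad(u_b), for b a root: they
multiply u_c by
    lambda_b (1 - beta(c, b)) (1 - beta(c, b)^-1),
with lambda_b a nonzero scalar ([ad_ad_opp]). Take x nonzero in I with a support
of minimal size. Subtracting from ad(u_(-b)) ad(u_b) x a multiple of x that
kills one coefficient must give 0, so that for all a and a' in the support of x
and every root b,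
    beta(a, b) = beta(a', b)  or  beta(a, b) beta(a', b) = 1
([minimal_eigen]). The bracket of u_b and x, when it is not 0, also has minimal
support, so it obeys the same rule ([minimal_ad]). If a <> a',
some root b violates the first alternative, and the rule for the pair a, a'
tested on the root a, then for the pair b + a, b + a' tested on the root a + b,
yields a contradiction ([minimal_monomial]). So x is a multiple of a single
u_a.

Conversely the summands of a direct sum of root systems are pairwise disjoint
and orthogonal, so they span ideals whose direct sum is L(R)
([direct_sum_ideal], [direct_sum_root_space]); in particular a decomposable R
gives a proper nonzero ideal. Summands of a reduced system are reduced
([direct_sum_reduced]), which brings the second claim back to the first. *)

Set Implicit Arguments.
Unset Strict Implicit.
Unset Printing Implicit Defensive.

Import GRing.Theory.
Local Open Scope classical_set_scope.
Local Open Scope ring_scope.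

(** * Subgroups given as sets *)

Lemma subgroup0 (G : zmodType) (H : set G) : subgroup H -> H 0.
Proof. by case; rewrite inE. Qed.

Lemma subgroupB (G : zmodType) (H : set G) a b :
  subgroup H -> H a -> H b -> H (a - b).
Proof. by case=> _ HB Ha Hb; have := HB a b; rewrite !inE; apply. Qed.

Lemma subgroupN (G : zmodType) (H : set G) a : subgroup H -> H a -> H (- a).
Proof.
by move=> sH Ha; rewrite -sub0r; apply: subgroupB => //; apply: subgroup0.
Qed.

Lemma subgroupI (G : zmodType) (H : set G) :
  H 0 -> (forall a b, H a -> H b -> H (a - b)) -> subgroup H.
Proof. by move=> H0 HB; split=> [|a b]; rewrite !inE //; apply: HB. Qed.

Lemma subgroup_generated_subgroup (G : zmodType) (S : set G) :
  subgroup (subgroup_generated S).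
Proof.
apply: subgroupI => [A [sA _]|a b Sa Sb A [sA SA]]; first exact: subgroup0.
by apply: subgroupB => //; [apply: Sa | apply: Sb].
Qed.

(** * Alternating bicharacters and the adjacency of roots *)

Section Bicharacter.
Variables (F : fieldType) (G : zmodType) (beta : G -> G -> F).
Hypothesis betaP : alternating_bicharacter beta.
Implicit Types (a b g : G) (H R C D : set G).

Lemma bichar0l b : beta 0 b = 1.
Proof.
apply: (mulfI (bichar_neq0 betaP 0 b)).
by rewrite mulr1 -(bicharDl betaP) addr0.
Qed.

Lemma bicharNl a b : beta (- a) b = (beta a b)^-1.
Proof.
apply: (mulIf (bichar_neq0 betaP a b)).
by rewrite -(bicharDl betaP) addNr bichar0l mulVf // (bichar_neq0 betaP).
Qed.

Lemma bicharC a b : beta b a = (beta a b)^-1.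
Proof.
apply: (mulIf (bichar_neq0 betaP a b)); rewrite mulVf ?(bichar_neq0 betaP) //.
have := bichar_alt betaP (a + b).
by rewrite (bicharDl betaP) !(bicharDr betaP) !(bichar_alt betaP) mul1r mulr1 mulrC.
Qed.

Lemma bicharNr a b : beta a (- b) = (beta a b)^-1.
Proof. by rewrite [LHS]bicharC bicharNl -bicharC. Qed.

Lemma orthogonalC a b : beta a b = 1 -> beta b a = 1.
Proof. by move=> ab; rewrite bicharC ab invr1. Qed.

Lemma orthogonal_generated R g :
  (forall a, R a -> beta g a = 1) ->
  forall h, subgroup_generated R h -> beta g h = 1.
Proof.
move=> gR; apply: (@smallest_sub _ _ _ [set h | beta g h = 1]) => //.
apply: subgroupI => /= [|a b ga gb]; first exact/orthogonalC/bichar0l.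
by rewrite (bicharDr betaP) bicharNr ga gb invr1 mulr1.
Qed.

(** A root orthogonal to all roots would be orthogonal to the group they
generate, that is, in the radical. *)
Lemma root_neighbour H R a : skew_root_system beta H R -> R a ->
  exists2 b, R b & beta a b <> 1.
Proof.
move=> srs Ra; apply: contrapT => noN; have [Ha] := srs_sub srs Ra; apply.
split=> //; rewrite -(srs_gen srs); apply: orthogonal_generated => b Rb.
by apply: contrapT => nab; apply: noN; exists b.
Qed.

Lemma roots_nonempty H R : skew_root_system beta H R -> R !=set0.
Proof.
move=> srs; apply: contrapT => R0; apply: (srs_rad srs).
apply/seteqP; split=> [h [] //|h Hh]; split=> //.
by rewrite -(srs_gen srs); apply: orthogonal_generated => a Ra; case: R0; exists a.
Qed.

(** The difference of two roots with the same pairing against R is in the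
radical, which is 0 in a reduced system. *)
Lemma roots_separate H R a a' : reduced_skew_root_system beta H R ->
  R a -> R a' -> a <> a' -> exists2 b, R b & beta a b <> beta a' b.
Proof.
move=> [srs rad0] Ra Ra' naa'; apply: contrapT => noN; apply: naa'.
have [Ha _] := srs_sub srs Ra; have [Ha' _] := srs_sub srs Ra'.
apply/eqP; rewrite -subr_eq0; apply/eqP.
suff : radical beta H (a - a') by rewrite rad0.
split; first exact: subgroupB (srs_subgroup srs) _ _.
rewrite -(srs_gen srs); apply: orthogonal_generated => b Rb.
rewrite (bicharDl betaP) bicharNl.
have -> : beta a b = beta a' b by apply: contrapT => ?; apply: noN; exists b.
by rewrite mulfV // (bichar_neq0 betaP).
Qed.

(** A union of connected components is a root system: a root a of C has a
neighbour b, which is again in C and adjacent to - a; and a + b, for any b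
adjacent to a, is adjacent to a. *)
Lemma srs_generate_closed H R C : skew_root_system beta H R ->
  C `<=` R -> C !=set0 ->
  (forall a b, C a -> R b -> beta a b <> 1 -> C b) ->
  skew_root_system beta (subgroup_generated C) C.
Proof.
move=> srs CR [c Cc] Cadj.
have nbr a : C a -> exists2 b, C b & beta a b <> 1.
  move=> Ca; have [b Rb nab] := root_neighbour srs (CR _ Ca).
  by exists b => //; apply: Cadj nab.
have C_nrad a : C a -> ~ radical beta (subgroup_generated C) a.
  move=> Ca [_ orth]; have [b Cb] := nbr a Ca; apply; apply: orth.
  exact: sub_gen_smallest.
split=> //.
- exact: subgroup_generated_subgroup.
- move=> radC; apply: (C_nrad c Cc); rewrite radC; exact: sub_gen_smallest.
- by move=> a Ca; split; [apply: sub_gen_smallest | apply: C_nrad].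
- move=> a Ca; have [b Cb nab] := nbr a Ca.
  apply: (Cadj b) => //; first exact: srs_opp srs _ (CR _ Ca).
  by rewrite bicharNr -bicharC.
- move=> a b Ca Cb nab; apply: (Cadj a) => //.
    by apply: srs_add srs _ _ _ _ nab; apply: CR.
  by rewrite (bicharDr betaP) (bichar_alt betaP) mul1r.
Qed.

Lemma generated_orthogonal C D :
  (forall a b, C a -> D b -> beta a b = 1) ->
  orthogonal_subsets beta (subgroup_generated C) (subgroup_generated D).
Proof.
move=> CD a b aC; apply: orthogonal_generated => d Dd.
apply: orthogonalC; move: a aC; apply: orthogonal_generated => c Cc.
by apply: orthogonalC; apply: CD.
Qed.

(** An indecomposable system has a connected adjacency graph: otherwise C and
its complement would split the group. *)
Lemma indecomposable_closed H R C : reduced_skew_root_system beta H R ->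
  indecomposable beta H R -> C `<=` R -> C !=set0 ->
  (forall a b, C a -> R b -> beta a b <> 1 -> C b) -> R `<=` C.
Proof.
move=> [srs rad0] indec CR C0 Cadj; apply: contrapT => nRC; apply: indec.
pose D := R `\` C.
have DR : D `<=` R by move=> a [].
have D0 : D !=set0.
  apply: contrapT => D0; apply: nRC => a Ra; apply: contrapT => nCa.
  by apply: D0; exists a.
have Dadj a b : D a -> R b -> beta a b <> 1 -> D b.
  move=> [Ra nCa] Rb nab; split=> // Cb; apply: nCa; apply: (Cadj b) => //.
  by move/orthogonalC.
have CD a b : C a -> D b -> beta a b = 1.
  by move=> Ca [Rb nCb]; apply: contrapT => nab; apply: nCb; apply: Cadj nab.
have orthCD := generated_orthogonal CD.
have sH := srs_subgroup srs.
have subH (S : set G) : S `<=` R -> subgroup_generated S `<=` H.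
  move=> SR; apply: smallest_sub => // a Sa; have [] // := srs_sub srs (SR _ Sa).
have sC := subgroup_generated_subgroup C.
have sD := subgroup_generated_subgroup D.
have genCD h : H h -> exists c d,
    [/\ subgroup_generated C c, subgroup_generated D d & h = c + d].
  rewrite -(srs_gen srs); move: h.
  apply: (@smallest_sub _ _ _ [set h | exists c d,
    [/\ subgroup_generated C c, subgroup_generated D d & h = c + d]]).
    apply: subgroupI => [|_ _ [c [d [cC dD ->]]] [c' [d' [cC' dD' ->]]]].
      by exists 0, 0; rewrite addr0; split=> //; apply: subgroup0.
    exists (c - c'), (d - d').
    split; [exact: subgroupB sC _ _ | exact: subgroupB sD _ _ |].
    by rewrite opprD addrACA.
  move=> a Ra; have [Ca|nCa] := pselect (C a).
    exists a, 0; rewrite addr0; split=> //; first exact: sub_gen_smallest.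
    exact: subgroup0.
  exists 0, a; rewrite add0r; split=> //; first exact: subgroup0.
  exact: sub_gen_smallest.
(* The sum is direct because the bicharacter is nonsingular. *)
have meet0 h : subgroup_generated C h -> subgroup_generated D h -> h = 0.
  move=> hC hD; suff : radical beta H h by rewrite rad0.
  split=> [|_ /genCD[c [d [cC dD ->]]]]; first exact: subH hC.
  rewrite (bicharDr betaP) (orthCD h d) // mulr1.
  by apply: orthogonalC; apply: orthCD.
pose Rs (i : 'I_2) := if i == ord0 then C else D.
have RsR i : Rs i `<=` R by rewrite /Rs; case: ifP.
exists (fun i => subgroup_generated (Rs i)), Rs.
have i2 (i : 'I_2) : i = ord0 \/ i = lift ord0 ord0.
  by case: i => [[|[|//]] ?]; [left | right]; apply: val_inj.
have RsRs i j : i != j -> orthogonal_subsets beta (Rs i) (Rs j).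
  move=> + a b; rewrite /Rs.
  case: (i2 i) => ->; case: (i2 j) => -> //= _; first exact: CD.
  by move=> Da Cb; apply: orthogonalC; apply: CD.
split; first split=> //.
- split=> [i|h /genCD[c [d [cC dD ->]]]]; first exact: subH.
  exists [ffun i : 'I_2 => if i == ord0 then c else d]; split.
    split=> [i|]; first by rewrite ffunE /Rs; case: ifP.
    by rewrite big_ord_recl big_ord1 !ffunE.
  move=> f [fRs]; rewrite big_ord_recl big_ord1 => cdE.
  have fC := fRs ord0; have fD := fRs (lift ord0 ord0).
  rewrite /Rs /= in fC fD.
  have cE : c - f ord0 = f (lift ord0 ord0) - d.
    by apply/eqP; rewrite subr_eq addrAC [_ + f ord0]addrC -cdE addrK.
  have c0 : c - f ord0 = 0.
    apply: meet0; first exact: subgroupB sC cC fC.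
    by rewrite cE; apply: (subgroupB sD fD dD).
  apply/ffunP => i; rewrite ffunE; case: (i2 i) => -> /=.
    by apply/eqP; rewrite -subr_eq0 c0.
  by apply/eqP; rewrite eq_sym -subr_eq0 -cE c0.
- by move=> i j /RsRs/generated_orthogonal.
- apply/seteqP; split=> [a Ra|a [i _ /RsR//]].
  have [Ca|nCa] := pselect (C a); first by exists ord0.
  by exists (lift ord0 ord0).
- move=> i; rewrite /Rs.
  by case: ifP => _; apply: (srs_generate_closed srs).
have nz a : R a -> a <> 0.
  by move=> Ra a0; have [_] := srs_sub srs Ra; rewrite rad0; apply.
move=> i; split; first exact: subH.
move=> Hi; case: (i2 i) => iE.
  have [d Dd] := D0; apply: (nz d (DR d Dd)); apply: meet0.
    have := Hi d; rewrite iE; apply; case: (srs_sub srs (DR d Dd)) => //.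
  exact: sub_gen_smallest.
have [c Cc] := C0; apply: (nz c (CR c Cc)); apply: meet0.
  exact: sub_gen_smallest.
by have := Hi c; rewrite iE; apply; case: (srs_sub srs (CR c Cc)).
Qed.

End Bicharacter.

(** * Ideals and spans of roots *)

Section Ideals.
Variables (F : fieldType) (V : lmodType F) (br : V -> V -> V) (L I : set V).
Hypothesis idI : lie_ideal br L I.

Lemma ideal0 : I 0.
Proof. by case: (ideal_subspace idI); rewrite inE. Qed.

Lemma idealZ c x : I x -> I (c *: x).
Proof.
move=> Ix; have [_ Ilin] := ideal_subspace idI.
by have := Ilin c x 0; rewrite !inE addr0; apply=> //; apply: ideal0.
Qed.

Lemma idealD x y : I x -> I y -> I (x + y).
Proof.
move=> Ix; have [_ Ilin] := ideal_subspace idI.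
by have := Ilin 1 x y; rewrite !inE scale1r; apply.
Qed.

Lemma idealB x y : I x -> I y -> I (x - y).
Proof. by move=> Ix Iy; rewrite -scaleN1r; apply/idealD/idealZ. Qed.

End Ideals.

Section MonoidAlgebra.
Variables (F : fieldType) (G : zmodType).
Implicit Types (x y z : {malg F[G]}) (A B C R : set G).

Lemma root_space_submod R : submod_closed [in root_space F R].
Proof.
split=> [|c x y]; rewrite !inE; first by move=> a /=; rewrite mcoeff0 eqxx.
move=> Rx Ry a /=; rewrite mcoeffD mcoeffZ => nz.
have [xa|/Rx//] := eqVneq x@_a 0.
by apply: Ry; move: nz; rewrite xa mulr0 add0r.
Qed.

Lemma root_space0 R : root_space F R 0.
Proof. by move=> a; rewrite mcoeff0 eqxx. Qed.

Lemma root_spaceD R x y : root_space F R x -> root_space F R y ->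
  root_space F R (x + y).
Proof.
move=> Rx Ry a; rewrite mcoeffD; have [->|/Rx//] := eqVneq x@_a 0.
by rewrite add0r => /Ry.
Qed.

Lemma root_spaceU R c a : R a -> root_space F R << c *g a >>.
Proof.
move=> Ra b; rewrite mcoeffU; have [<- //|_] := eqVneq a b.
by rewrite mulr0n eqxx.
Qed.

Lemma root_spaceU1 R a : root_space F R << a >> -> R a.
Proof. by apply; rewrite mcoeffUU oner_eq0. Qed.

(** Linear induction: monomials with arbitrary coefficients are used as
generators, so that scaling needs no separate case. *)
Lemma root_space_ind R (P : {malg F[G]} -> Prop) :
  P 0 -> (forall x y, P x -> P y -> P (x + y)) ->
  (forall c a, R a -> P << c *g a >>) ->
  forall x, root_space F R x -> P x.
Proof.
move=> P0 PD PU x Rx; rewrite [x]monalgE big_seq.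
apply: big_ind => // a ax; apply: PU; apply: Rx.
by rewrite mcoeff_neq0.
Qed.

Lemma malg_ind (P : {malg F[G]} -> Prop) :
  P 0 -> (forall x y, P x -> P y -> P (x + y)) ->
  (forall c a, P << c *g a >>) -> forall x, P x.
Proof. by move=> P0 PD PU x; apply: (@root_space_ind setT P). Qed.

Lemma scale_malgU (c d : F) (a : G) : c *: << d *g a >> = << c * d *g a >>.
Proof. by apply/malgP => b; rewrite mcoeffZ !mcoeffU mulrnAr. Qed.

End MonoidAlgebra.

(** * The twisted group algebra and its bracket *)

Section TwistedGroupAlgebra.
Variables (F : fieldType) (G : zmodType) (xi : G -> G -> F).
Implicit Types (x y z : {malg F[G]}) (A B C R : set G).
Local Notation mul := (twisted_mul xi).
Local Notation br := (twisted_bracket xi).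

(** Enlarging the index sets puts products with different supports on a common
footing, which is what bilinearity needs. *)
Lemma twisted_mulEw (A B : {fset G}) x y :
  (msupp x `<=` A)%fset -> (msupp y `<=` B)%fset ->
  mul x y = \sum_(a <- A) \sum_(b <- B)
    << x@_a * y@_b * xi a b *g (a + b)%R >>.
Proof.
move=> xA yB; rewrite /twisted_mul (big_fset_incl _ xA) => [|a _ xa] /=.
  apply: eq_bigr => a _; rewrite (big_fset_incl _ yB) // => b _ yb.
  by rewrite (mcoeff_outdom yb) mulr0 mul0r monalgU0.
by rewrite big1 // => b _; rewrite (mcoeff_outdom xa) !mul0r monalgU0.
Qed.

Lemma twisted_mulDl x y z : mul (x + y) z = mul x z + mul y z.
Proof.
pose A := (msupp x `|` msupp y)%fset; pose B := msupp z.
rewrite (@twisted_mulEw A B (x + y)) ?msuppD_le //.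
rewrite (@twisted_mulEw A B x) ?fsubsetUl // (@twisted_mulEw A B y) ?fsubsetUr //.
rewrite -big_split; apply: eq_bigr => a _.
rewrite -big_split; apply: eq_bigr => b _.
by rewrite mcoeffD !mulrDl monalgUD.
Qed.

Lemma twisted_mulDr x y z : mul z (x + y) = mul z x + mul z y.
Proof.
pose A := (msupp x `|` msupp y)%fset; pose B := msupp z.
rewrite (@twisted_mulEw B A z (x + y)) ?msuppD_le //.
rewrite (@twisted_mulEw B A z x) ?fsubsetUl // (@twisted_mulEw B A z y) ?fsubsetUr //.
rewrite -big_split; apply: eq_bigr => a _.
rewrite -big_split; apply: eq_bigr => b _.
by rewrite mcoeffD mulrDr !mulrDl monalgUD.
Qed.

Lemma twisted_mulZl c x y : mul (c *: x) y = c *: mul x y.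
Proof.
rewrite (@twisted_mulEw (msupp x) (msupp y)) ?msuppZ_le //.
rewrite /twisted_mul scaler_sumr.
apply: eq_bigr => a _; rewrite scaler_sumr; apply: eq_bigr => b _.
by rewrite scale_malgU mcoeffZ !mulrA.
Qed.

Lemma twisted_mulZr c x y : mul x (c *: y) = c *: mul x y.
Proof.
rewrite (@twisted_mulEw (msupp x) (msupp y)) ?msuppZ_le //.
rewrite /twisted_mul scaler_sumr.
apply: eq_bigr => a _; rewrite scaler_sumr; apply: eq_bigr => b _.
by rewrite scale_malgU mcoeffZ mulrCA !mulrA.
Qed.

Lemma twisted_mul0l x : mul 0 x = 0.
Proof. by have := twisted_mulZl 0 0 x; rewrite !scale0r. Qed.

Lemma twisted_mul0r x : mul x 0 = 0.
Proof. by have := twisted_mulZr 0 x 0; rewrite !scale0r. Qed.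

Lemma twisted_mulUU c d a b :
  mul << c *g a >> << d *g b >> = << c * d * xi a b *g (a + b)%R >>.
Proof.
rewrite (twisted_mulEw msuppU_le msuppU_le).
by rewrite !big_seq_fset1 !mcoeffUU.
Qed.

Lemma twisted_bracketC x y : br y x = - br x y.
Proof. by rewrite /twisted_bracket opprB. Qed.

Lemma twisted_bracketDl x y z : br (x + y) z = br x z + br y z.
Proof. by rewrite /twisted_bracket twisted_mulDl twisted_mulDr opprD addrACA. Qed.

Lemma twisted_bracketZl c x y : br (c *: x) y = c *: br x y.
Proof. by rewrite /twisted_bracket twisted_mulZl twisted_mulZr scalerBr. Qed.

Lemma twisted_bracketDr x y z : br z (x + y) = br z x + br z y.
Proof. by rewrite !(twisted_bracketC _ z) twisted_bracketDl opprD. Qed.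

Lemma twisted_bracketZr c x y : br x (c *: y) = c *: br x y.
Proof. by rewrite !(twisted_bracketC _ x) twisted_bracketZl scalerN. Qed.

Lemma twisted_bracket0l x : br 0 x = 0.
Proof. by have := twisted_bracketZl 0 0 x; rewrite !scale0r. Qed.

Lemma twisted_bracket0r x : br x 0 = 0.
Proof. by rewrite twisted_bracketC twisted_bracket0l oppr0. Qed.

Lemma twisted_bracketUU c d a b : br << c *g a >> << d *g b >> =
  << c * d * (xi a b - xi b a) *g (a + b)%R >>.
Proof.
rewrite /twisted_bracket !twisted_mulUU [(b + a)%R]addrC -monalgUB.
by rewrite mulrBr (mulrC d).
Qed.

(** Bracketing with u_a shifts degrees by a, so each coefficient of the result
comes from a single coefficient of x. *)
Lemma mcoeff_ad a c x :
  (br << a >> x)@_(a + c) = (xi a c - xi c a) * x@_c.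
Proof.
elim/malg_ind: x => [|x y IHx IHy|d b].
- by rewrite twisted_bracket0r !mcoeff0 mulr0.
- by rewrite twisted_bracketDr mcoeffD IHx IHy mcoeffD mulrDr.
rewrite twisted_bracketUU !mcoeffU (inj_eq (addrI a)).
by case: eqP => [->|_]; rewrite ?mulr0n ?mulr0 // !mulr1n mul1r mulrC.
Qed.

Lemma msupp_ad a x :
  (msupp (br << a >> x) `<=` [fset (a + c)%R | c in msupp x])%fset.
Proof.
apply/fsubsetP => c; rewrite -mcoeff_neq0 -{1}[c](subrKC a) mcoeff_ad => nz.
apply/imfsetP; exists (c - a); last by rewrite subrKC.
by rewrite /= -mcoeff_neq0; apply: contraNneq nz => ->; rewrite mulr0.
Qed.

Hypothesis xiP : cocycle2 xi.

(** By trilinearity associativity reduces to monomials, where it is the cocycle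
identity. *)
Lemma twisted_mulA x y z : mul x (mul y z) = mul (mul x y) z.
Proof.
elim/malg_ind: x => [|x x' IH IH'|c a]; first by rewrite !twisted_mul0l.
  by rewrite !twisted_mulDl IH IH'.
elim/malg_ind: y => [|y y' IH IH'|d b].
- by rewrite !(twisted_mul0l, twisted_mul0r).
- by rewrite !(twisted_mulDl, twisted_mulDr) IH IH'.
elim/malg_ind: z => [|z z' IH IH'|e k]; first by rewrite !twisted_mul0r.
  by rewrite !twisted_mulDr IH IH'.
rewrite !twisted_mulUU addrA; congr (mkmalgU _ _).
have e1 := cocycleP xiP a b k.
rewrite -[RHS]mulrA [X in _ = _ * X]mulrC.
transitivity (c * d * e * (xi b k * xi a (b + k))); first by ring.
by rewrite e1; ring.
Qed.

Variable beta : G -> G -> F.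
Hypothesis betaP : alternating_bicharacter beta.
Hypothesis xi_beta : forall a b : G, xi a b * (xi b a)^-1 = beta a b.

Lemma xi_commutator a b : xi a b - xi b a = xi a b * (1 - beta b a).
Proof.
by rewrite -xi_beta mulrBr mulr1 mulrCA mulfV ?mulr1 // (cocycle_neq0 xiP).
Qed.

Lemma bracket_root_space A B C x y :
  (forall a b, A a -> B b -> beta a b <> 1 -> C (a + b)) ->
  root_space F A x -> root_space F B y -> root_space F C (br x y).
Proof.
move=> ABC Ax By; elim/(@root_space_ind F G A): x / Ax => [|x1 x2 IH1 IH2|c a Aa].
- by rewrite twisted_bracket0l; apply: root_space0.
- by rewrite twisted_bracketDl; apply: root_spaceD.
elim/(@root_space_ind F G B): y / By => [|y1 y2 IH1 IH2|d b Bb].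
- by rewrite twisted_bracket0r; apply: root_space0.
- by rewrite twisted_bracketDr; apply: root_spaceD.
rewrite twisted_bracketUU xi_commutator.
have [ba1|nba] := eqVneq (beta b a) 1.
  by rewrite ba1 subrr !mulr0 monalgU0; apply: root_space0.
apply: root_spaceU; apply: ABC => // /(orthogonalC betaP).
exact/eqP.
Qed.

Lemma root_space_lie R :
  (forall a b, R a -> R b -> beta a b <> 1 -> R (a + b)) ->
  lie_algebra br (root_space F R).
Proof.
move=> RD; split.
- exact: root_space_submod.
- by move=> x y; apply: bracket_root_space.
- by move=> c x y z _ _ _; rewrite twisted_bracketDl twisted_bracketZl.
- by move=> c x y z _ _ _; rewrite twisted_bracketDr twisted_bracketZr.
- by move=> x _; rewrite /twisted_bracket subrr.
move=> x y z _ _ _; rewrite /twisted_bracket.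
have mulN u v : mul (- u) v = - mul u v.
  by rewrite -scaleN1r twisted_mulZl scaleN1r.
have mulNr u v : mul u (- v) = - mul u v.
  by rewrite -scaleN1r twisted_mulZr scaleN1r.
rewrite !(twisted_mulDl, twisted_mulDr, mulN, mulNr) !twisted_mulA.
move: (mul (mul x y) z) (mul (mul y z) x) (mul (mul z x) y).
move: (mul (mul y x) z) (mul (mul z y) x) (mul (mul x z) y).
move=> yxz zyx xzy xyz yzx zxy.
by apply/malgP => a; rewrite !(mcoeffD, mcoeffN, mcoeff0); ring.
Qed.

Lemma root_space_ideal R C : C `<=` R ->
  (forall a b, R a -> C b -> beta a b <> 1 -> C (a + b)) ->
  lie_ideal br (root_space F R) (root_space F C).
Proof.
move=> CR RC; split; first by move=> x Cx a /Cx/CR.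
  exact: root_space_submod.
by move=> x y; apply: bracket_root_space.
Qed.

(** The substitute for a torus: a degree-preserving operator that lies in the
algebra generated by the ad(u_b). The scalar of degree c depends on c only
through beta(c, b), up to inversion, since the cocycle identity turns
xi(-b, b + c) xi(b, c) into xi(0, c) xi(-b, b) and xi(0, c) = xi(0, 0). *)
Lemma ad_ad_opp b c x :
  (br << (- b)%R >> (br << b >> x))@_c =
  xi 0 0 * xi (- b)%R b * (1 - beta c b) * (1 - (beta c b)^-1) * x@_c.
Proof.
have xi0 : xi 0 c = xi 0 0.
  have := cocycleP xiP 0 0 c; rewrite !add0r.
  by move/(mulfI (cocycle_neq0 xiP 0 c)).
have := cocycleP xiP (- b)%R b c; rewrite addNr xi0 => xiE.
rewrite -[in LHS](addKr b c) !mcoeff_ad !xi_commutator.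
rewrite (bicharNr betaP) (bicharDl betaP) (bichar_alt betaP) mul1r -xiE.
by ring.
Qed.

(** * Elements of minimal support in an ideal *)

Section Ideal.
Variables (R : set G) (I : set {malg F[G]}).
Hypothesis Ropp : forall a, R a -> R (- a).
Hypothesis idI : lie_ideal br (root_space F R) I.

Let Iad b x : R b -> I x -> I (br << b >> x).
Proof. by move=> Rb; apply: (ideal_br idI); apply: root_spaceU. Qed.

Definition minimal_in_ideal x := [/\ I x, x <> 0 &
  forall y, I y -> y <> 0 -> (#|` msupp x| <= #|` msupp y|)%N].

Lemma minimal_exists x : I x -> x <> 0 -> exists y, minimal_in_ideal y.
Proof.
move: {2}#|` _|.+1 (ltnSn #|` msupp x|) => n; elim: n x => // n IHn x xn Ix x0.
have [[y [Iy y0 yx]]|min] :=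
    pselect (exists y, [/\ I y, y <> 0 & (#|` msupp y| < #|` msupp x|)%N]).
  by apply: (IHn y) => //; apply: leq_trans yx _.
exists x; split=> // y Iy y0; rewrite leqNgt; apply/negP => yx.
by apply: min; exists y.
Qed.

(** The support of the bracket is contained in a translate of the support of
x. *)
Lemma minimal_ad b x : R b -> minimal_in_ideal x -> br << b >> x <> 0 ->
  minimal_in_ideal (br << b >> x).
Proof.
move=> Rb [Ix x0 xmin] nz; split=> // [|y Iy y0]; first exact: Iad.
apply: leq_trans (xmin y Iy y0).
apply: leq_trans (fsubset_leq_card (msupp_ad b x)) _.
exact: leq_imfset_card.
Qed.

(** If the degrees a and a' had different eigenvalues, subtracting the right
multiple of x from its image would kill the coefficient of a but not that of
a'. Equal eigenvalues for p = beta(a, b) and q = beta(a', b) mean p = q or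
p q = 1, because (1 - p) (1 - p^-1) = 2 - p - p^-1. *)
Lemma minimal_eigen b x a a' : R b -> minimal_in_ideal x ->
  x@_a != 0 -> x@_a' != 0 ->
  beta a b = beta a' b \/ beta a b * beta a' b = 1.
Proof.
move=> Rb [Ix x0 xmin] xa xa'.
(* The eigenvalue of ad(u_(-b)) ad(u_b) in degree c. *)
pose ev c := xi 0 0 * xi (- b) b * (1 - beta c b) * (1 - (beta c b)^-1).
pose y := br << - b >> (br << b >> x) - ev a *: x.
have yE c : y@_c = (ev c - ev a) * x@_c.
  by rewrite mcoeffB ad_ad_opp mcoeffZ mulrBl.
have y0 : y = 0.
  apply: contrapT => nz.
  have Iy : I y.
    apply: (idealB idI); last exact: (idealZ idI).
    by do 2![apply: Iad; first by auto].
  have := xmin y Iy nz; rewrite leqNgt => /negP; apply.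
  apply/fproper_ltn_card/andP; split; [apply/fsubsetP => c | apply/fsubsetPn].
    by rewrite -!mcoeff_neq0 yE; apply: contraNneq => ->; rewrite mulr0.
  by exists a; rewrite -mcoeff_neq0 // yE subrr mul0r eqxx.
have /eqP := yE a'; rewrite y0 mcoeff0 eq_sym mulf_eq0 (negPf xa') orbF.
have n0 := mulf_neq0 (cocycle_neq0 xiP 0 0) (cocycle_neq0 xiP (- b) b).
rewrite /ev -!(mulrA (xi 0 0 * _)) -mulrBr mulf_eq0 (negPf n0) /= => /eqP e.
have p0 := bichar_neq0 betaP a b; have q0 := bichar_neq0 betaP a' b.
have : (beta a b - beta a' b) * (beta a b * beta a' b - 1) = 0.
  rewrite -[RHS](mulr0 (beta a b * beta a' b)) -e; field.
  by rewrite p0 q0.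
move/eqP; rewrite mulf_eq0 !subr_eq0 => /orP[]/eqP; by [left | right].
Qed.

End Ideal.

(** Suppose a <> a' are both in the support, and let b be a root with
p = beta(a, b) different from beta(a', b). Then beta(a', b) = p^-1, so that
p^2 <> 1. Testing a and a' on the root a gives beta(a', a) = 1. As p <> 1,
a + b is a root, and the bracket of u_b and x is again minimal, with b + a and
b + a' in its support. These pair with a + b to 1 and p^-2 respectively, so
both alternatives of the rule say that p^2 = 1. *)
Lemma minimal_monomial H R I x a a' :
  reduced_skew_root_system beta H R ->
  lie_ideal br (root_space F R) I -> minimal_in_ideal I x ->
  x@_a != 0 -> x@_a' != 0 -> a = a'.
Proof.
move=> red idI xmin xa xa'; have [srs _] := red.
have Ropp := srs_opp srs.
have Rx : root_space F R x by case: xmin => Ix _ _; apply: ideal_sub idI _ Ix.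
have Ra := Rx _ xa; have Ra' := Rx _ xa'.
apply: contrapT => naa'.
have [b Rb nab] := roots_separate betaP red Ra Ra' naa'.
have [/nab[]|pq1] := minimal_eigen Ropp idI Rb xmin xa xa'.
have a'b : beta a' b = (beta a b)^-1.
  by apply: (mulfI (bichar_neq0 betaP a b)); rewrite pq1 mulfV ?(bichar_neq0 betaP).
rewrite a'b in nab.
have p0 := bichar_neq0 betaP a b.
have p1 : beta a b <> 1 by move=> p1; apply: nab; rewrite p1 invr1.
have p2 : beta a b * beta a b <> 1.
  by move=> p2; apply: nab; apply: (mulfI p0); rewrite p2 mulfV.
have a'a : beta a' a = 1.
  have [] := minimal_eigen Ropp idI Ra xmin xa xa'; rewrite (bichar_alt betaP) //.
  by rewrite mul1r.
have ad_nz c : x@_c != 0 -> beta c b <> 1 -> (br << b >> x)@_(b + c) != 0.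
  move=> xc nc; rewrite mcoeff_ad xi_commutator !mulf_neq0 ?(cocycle_neq0 xiP) //.
  by rewrite subr_eq0 eq_sym; apply/eqP.
have ya := ad_nz a xa p1.
have ya' : (br << b >> x)@_(b + a') != 0.
  by apply: ad_nz => //; rewrite a'b => /(congr1 GRing.inv); rewrite invrK invr1.
have ymin : minimal_in_ideal I (br << b >> x).
  apply: (minimal_ad idI) => // y0.
  by move: ya; rewrite y0 mcoeff0 eqxx.
have Rab : R (a + b) by apply: srs_add srs _ _ _ _ p1.
have := minimal_eigen Ropp idI Rab ymin ya ya'.
rewrite !(bicharDl betaP) !(bicharDr betaP) !(bichar_alt betaP) a'a a'b.
rewrite (bicharC betaP a b) !mul1r !mulr1 mulVf // mul1r.
case=> [|/eqP].
  by move/esym/(congr1 GRing.inv); rewrite invfM invrK invr1 => /p2.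
by rewrite -invfM invr_eq1 => /eqP/p2.
Qed.

(** * Simplicity and decomposability *)

Lemma indecomposable_simple H R :
  reduced_skew_root_system beta H R -> indecomposable beta H R ->
  lie_simple br (root_space F R).
Proof.
move=> red indec; have [srs _] := red.
have sub1 c a b : c != 0 -> beta a b <> 1 -> c * (1 - beta a b) != 0.
  by move=> c0 nab; rewrite mulf_neq0 // subr_eq0 eq_sym; apply/eqP.
have [a0 Ra0] := roots_nonempty betaP srs.
split.
- exact: root_space_lie (srs_add srs).
- have [b Rb nab] := root_neighbour betaP srs Ra0.
  exists << b >>, << a0 >>; split; try exact: root_spaceU.
  rewrite twisted_bracketUU xi_commutator !mul1r; apply/eqP.
  by rewrite monalgU_eq0 sub1 ?(cocycle_neq0 xiP).
move=> I idI; have [I0|nI0] := pselect (I `<=` [set 0]).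
  by left; apply/seteqP; split=> // _ ->; apply: (ideal0 idI).
right; have [x Ix /= x0] : exists2 x, I x & x <> 0.
  apply: contrapT => nx; apply: nI0 => x Ix; apply: contrapT => x0.
  by apply: nx; exists x.
have IU c a : c != 0 -> I << c *g a >> -> I << a >>.
  by move=> c0 /(idealZ idI c^-1); rewrite scale_malgU mulVf.
have adU a b : R b -> beta a b <> 1 -> I << a >> -> I << b + a >>.
  move=> Rb nab Ia; have := ideal_br idI (@root_spaceU F G R 1 b Rb) Ia.
  rewrite twisted_bracketUU xi_commutator !mul1r; apply: IU.
  by apply: sub1; rewrite ?(cocycle_neq0 xiP).
pose C := [set a | R a /\ I << a >>].
have CR : R `<=` C.
  apply: (indecomposable_closed betaP red indec) => [a []//||a b [Ra Ia] Rb nab].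
    have [y ymin] := minimal_exists Ix x0.
    have [Iy y0 _] := ymin.
    have [a ya] : exists a, y@_a != 0.
      apply: contrapT => ya; apply: y0; apply/malgP => a; rewrite mcoeff0.
      by apply: contrapT => ya0; apply: ya; exists a; apply/eqP.
    exists a; split; first exact: (ideal_sub idI Iy).
    apply: (IU _ _ ya); suff -> : << y@_a *g a >> = y by [].
    apply/malgP => c; rewrite mcoeffU; case: eqVneq => [->//|ac].
    rewrite mulr0n; apply/esym/eqP/negPn/negP => yc.
    by move/eqP: ac; apply; apply: (minimal_monomial red idI ymin).
  (* From a one reaches a + b, and the bracket with u_(-a) then leads to b. *)
  split=> //; have := adU (b + a) (- a) (srs_opp srs Ra) _ (adU a b Rb nab Ia).
  rewrite [b + a]addrC addKr; apply.
  rewrite (bicharDl betaP) !(bicharNr betaP) (bichar_alt betaP) invr1 mul1r.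
  by rewrite -(bicharC betaP).
apply/seteqP; split=> [y|y Ry]; first exact: (ideal_sub idI).
elim/(@root_space_ind F G R): y / Ry => [||c a /CR[_ Ia]].
- exact: (ideal0 idI).
- exact: (idealD idI).
by have := idealZ idI c Ia; rewrite scale_malgU mulr1.
Qed.

(** A common root of two summands would be orthogonal to its own
neighbours. *)
Lemma direct_sum_disjoint H R n (Hs Rs : 'I_n -> set G) i j a :
  srs_direct_sum beta H R Hs Rs -> Rs i a -> Rs j a -> i = j.
Proof.
move=> ds ia ja; apply/eqP/negPn/negP => ij.
have [b ib nab] := root_neighbour betaP (srs_sum_srs ds i) ia; apply: nab.
by rewrite eq_sym in ij; apply: (srs_sum_roots_orth ds ij ja ib).
Qed.

Lemma direct_sum_ideal H R n (Hs Rs : 'I_n -> set G) i :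
  srs_direct_sum beta H R Hs Rs ->
  lie_ideal br (root_space F R) (root_space F (Rs i)).
Proof.
move=> ds; rewrite (srs_sum_roots ds).
apply: root_space_ideal => [a ia|a b [j _ ja] ib nab]; first by exists i.
have ji : j = i.
  by apply/eqP/negPn/negP => ji; apply: nab; apply: (srs_sum_roots_orth ds ji).
by rewrite ji in ja; apply: (srs_add (srs_sum_srs ds i)).
Qed.

Lemma decomposable_not_simple H R : decomposable beta H R ->
  ~ lie_simple br (root_space F R).
Proof.
case=> Hs [Rs [ds _]] simple.
have Rs_nonempty i := roots_nonempty betaP (srs_sum_srs ds i).
have [a Ra] := Rs_nonempty ord0; have [b Rb] := Rs_nonempty (lift ord0 ord0).
case: (simple_ideals simple (direct_sum_ideal ord0 ds)) => E.
  have /= : root_space F (Rs ord0) << a >> by apply: root_spaceU.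
  by rewrite E /= => /eqP; rewrite monalgU_eq0 oner_eq0.
have : root_space F (Rs ord0) << b >>.
  by rewrite E (srs_sum_roots ds); apply: root_spaceU; exists (lift ord0 ord0).
by move/root_spaceU1 => R0b; have := direct_sum_disjoint ds R0b Rb.
Qed.

Lemma direct_sum_root_space R n (Rs : 'I_n -> set G) :
  R = \bigcup_i Rs i -> (forall i j a, Rs i a -> Rs j a -> i = j) ->
  internal_direct_sum (root_space F R) (fun i => root_space F (Rs i)).
Proof.
move=> RE disj; split=> [i x Rx a /Rx ia|x]; first by rewrite RE; exists i.
have sum_coef (f : 'I_n -> {malg F[G]}) i a :
    (forall j, root_space F (Rs j) (f j)) -> Rs i a ->
    (\sum_j f j)@_a = (f i)@_a.
  move=> fR ia; rewrite raddf_sum /= (bigD1 i) //= big1 ?addr0 // => j ji.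
  apply/eqP/negPn/negP => /fR ja.
  by move/eqP: ji; apply; apply: disj ja ia.
move=> Rx.
have [f [fR xE]] : exists f : {ffun 'I_n -> {malg F[G]}},
    (forall i, root_space F (Rs i) (f i)) /\ x = \sum_i f i.
  elim/(@root_space_ind F G R): x / Rx => [|x y [f [fR ->]] [g [gR ->]]|c a].
  - exists 0; split=> [i|]; first by rewrite ffunE; apply: root_space0.
    by rewrite big1 // => i _; rewrite ffunE.
  - exists (f + g); split=> [i|]; first by rewrite ffunE; apply: root_spaceD.
    by rewrite -big_split; apply: eq_bigr => i _; rewrite ffunE.
  rewrite RE => -[i _ ia]; exists [ffun j => if j == i then << c *g a >> else 0].
  split=> [j|].
    by rewrite ffunE; case: eqP => [->|_]; [apply: root_spaceU | apply: root_space0].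
  rewrite (bigD1 i) //= big1 ?addr0 ?ffunE ?eqxx // => j /negPf ji.
  by rewrite ffunE ji.
exists f; split=> // g [gR xE']; apply/ffunP => i; apply/malgP => a.
have [ia|nia] := pselect (Rs i a).
  by rewrite -(sum_coef f i a) // -(sum_coef g i a) // -xE -xE'.
have out (h : {malg F[G]}) : root_space F (Rs i) h -> h@_a = 0.
  by move=> hR; apply/eqP/negPn/negP => /hR.
by rewrite !out.
Qed.

(** The radical of a summand is orthogonal to that summand and to all others,
hence to the whole group. *)
Lemma direct_sum_reduced H R n (Hs Rs : 'I_n -> set G) i :
  reduced_skew_root_system beta H R -> srs_direct_sum beta H R Hs Rs ->
  reduced_skew_root_system beta (Hs i) (Rs i).
Proof.
move=> [srs rad0] ds; split; first exact: srs_sum_srs ds i.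
have [HsH Hdec] := srs_sum_group ds.
apply/seteqP; split=> [g [ig gorth]|_ ->]; last first.
  split=> [|h _]; last exact: bichar0l betaP h.
  by apply: subgroup0; apply: srs_subgroup (srs_sum_srs ds i).
rewrite -rad0; split=> [|h Hh]; first exact: HsH ig.
rewrite -(srs_gen srs) in Hh; move: h Hh.
apply: (orthogonal_generated betaP) => a; rewrite (srs_sum_roots ds) => -[j _ ja].
have jHa : Hs j a by have [] := srs_sub (srs_sum_srs ds j) ja.
have [ji|ij] := eqVneq i j; first by apply: gorth; rewrite ji.
exact: (srs_sum_group_orth ds ij).
Qed.

End TwistedGroupAlgebra.

Theorem theorem4p12 (F : closedFieldType) (charF : [pchar F] =i pred0)
  (G : zmodType) (fgG : finitely_generated G)
  (beta : G -> G -> F) (betaP : alternating_bicharacter beta)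
  (R : set G) (RP : reduced_skew_root_system beta [set: G] R)
  (xi : G -> G -> F) (xiP : cocycle2 xi)
  (xi_beta : forall a b : G, xi a b * (xi b a)^-1 = beta a b) :
  (indecomposable beta [set: G] R <->
     lie_simple (twisted_bracket xi) (root_space F R))
  /\
  (forall (n : nat) (Gs Rs : 'I_n -> set G),
     srs_direct_sum beta [set: G] R Gs Rs ->
     (forall i, indecomposable beta (Gs i) (Rs i)) ->
     lie_direct_sum (twisted_bracket xi) (root_space F R)
       (fun i => root_space F (Rs i)) /\
     (forall i, lie_simple (twisted_bracket xi) (root_space F (Rs i)))).
Proof.
split=> [|n Gs Rs ds indec].
  split; first exact: (indecomposable_simple xiP betaP xi_beta RP).
  by move=> simple /(decomposable_not_simple xiP betaP xi_beta).
split; last first.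
  move=> i; apply: (indecomposable_simple xiP betaP xi_beta _ (indec i)).
  exact: (direct_sum_reduced betaP i RP ds).
split.
- by apply: (root_space_lie xiP betaP xi_beta); case: RP => /srs_add.
- by move=> i; apply: (direct_sum_ideal xiP betaP xi_beta i ds).
apply: direct_sum_root_space; first exact: srs_sum_roots ds.
by move=> i j a; apply: (direct_sum_disjoint betaP ds).
Qed.
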